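(* For every $n\in\mathbb{Z}^+$ and every sequence $S=(s_1,s_2,\dots)$ of positive integers, $$|\mathrm{FR}^{\mathrm{T3}}_{n,S}|=\sum_{k=1}^n\sum_{(c_1,\dots,c_k)\in M_{S,k,n}}\binom{n}{c_1,c_2,\dots,c_k},$$ where $M_{S,k,n}=\{(c_1,\dots,c_k): c_1+\cdots+c_k=n \text{ and } c_i\in\{1,\dots,s_i\}\text{ for all }1\le i\le k\}$.
   Context: A Fubini ranking of length $n$ is a tuple $(b_1,\dots,b_n)\in[n]^n$ that satisfies two conditions. First, some $b_i$ equals $1$. Second, for every value $x$ occurring exactly $k>0$ times, the next larger value occurring in the tuple (if there is one) is $x+k$. If a Fubini ranking $\alpha$ has $k$ distinct values, its position vector is $(c_1,\dots,c_k)$, where $c_i$ is the number of entries of $\alpha$ equal to $1+c_1+\cdots+c_{i-1}$. A sequence $S=(s_1,s_2,\dots)$ of positive integers is a block sequence for $\alpha$ if $c_i\le s_i$ for $i=1,\dots,k$. $\mathrm{FR}^{\mathrm{T3}}_{n,S}$ is the set of Fubini rankings of length $n$ for which $S$ is a block sequence. *)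

(* Defs.v *)
From mathcomp Require Import all_boot.
Set Implicit Arguments.
Unset Strict Implicit.
Unset Printing Implicit Defensive.

(* The type 'I_n.+1 = {0, .., n} is used so that an entry is literally its
   value in the 1-based convention of the source; 0 is then excluded
   explicitly. *)
Definition entries n k (b : k.-tuple 'I_n.+1) : seq nat :=
  [seq val x | x <- b].

Definition next_value (b : seq nat) (x y : nat) : bool :=
  [&& y \in b, x < y & all (fun z => (x < z) ==> (y <= z)) b].

Definition fubini_seq (n : nat) (b : seq nat) : bool :=
  [&& size b == n, all (fun x => 1 <= x <= n) b, 1 \in b &
      all (fun x => all (fun y => next_value b x y ==>
                                  (y == x + count_mem x b)) b) b].

Definition fubini_ranking n (b : n.-tuple 'I_n.+1) : bool :=
  fubini_seq n (entries b).

(* First k terms of the recursion c_i = #{j | b_j = 1 + c_1 + .. + c_(i-1)}. *)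
Fixpoint position_prefix (b : seq nat) (k : nat) : seq nat :=
  if k is k'.+1 then
    let c := position_prefix b k' in rcons c (count_mem (1 + sumn c) b)
  else [::].

Definition position_vector (b : seq nat) : seq nat :=
  position_prefix b (size (undup b)).

(* Sequences are indexed from 0: [s i] is s_(i+1). *)
Definition block_sequence (s : nat -> nat) (b : seq nat) : bool :=
  let c := position_vector b in
  all (fun i => nth 0 c i <= s i) (iota 0 (size c)).

Definition FRT3 (n : nat) (s : nat -> nat) : {set n.-tuple 'I_n.+1} :=
  [set b : n.-tuple 'I_n.+1 |
     fubini_ranking b && block_sequence s (entries b)].

(* The bound c_i <= n built into the type is implied by c_1 + .. + c_k = n. *)
Definition M (s : nat -> nat) (k n : nat) : {set k.-tuple 'I_n.+1} :=
  [set c : k.-tuple 'I_n.+1 |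
     (\sum_(i < k) tnth c i == n) &&
     [forall i : 'I_k, 1 <= tnth c i <= s i]].

(* The division is exact whenever the entries of c sum to n. *)
Definition multinomial (n : nat) (c : seq nat) : nat :=
  n`! %/ \prod_(x <- c) x`!.

(* Main.v *)
Require Import Defs.
From mathcomp Require Import all_boot zify.

(** A Fubini ranking with position vector [c] is exactly a rearrangement of the
    word made of [c_1] copies of [1], [c_2] copies of [1 + c_1], and so on;
    conversely each such rearrangement is a Fubini ranking with position vector
    [c].  Grouping the rankings by position vector therefore leaves the count
    of the rearrangements of a word with letter multiplicities [c_1, .., c_k],
    which is a multinomial coefficient. *)

(** * Block words: letters, multiplicities and gaps *)

(** The starting letter [m] is a parameter because the tail of a block word is a block word starting
    at [m + a], as the inductions on [c] require. *)
Fixpoint block_word (m : nat) (c : seq nat) : seq nat :=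
  if c is a :: c' then nseq a m ++ block_word (m + a) c' else [::].

Lemma size_block_word m c : size (block_word m c) = sumn c.
Proof.
by elim: c m => //= a c IH m; rewrite size_cat size_nseq IH.
Qed.

Lemma block_word_bounds m c x : all (leq 1) c ->
  x \in block_word m c -> m <= x < m + sumn c.
Proof.
elim: c m => //= a c IH m /andP[a_gt0 c_gt0].
rewrite mem_cat mem_nseq => /orP[/andP[_ /eqP->]|/(IH _ c_gt0)]; lia.
Qed.

Lemma mem_block_word_start m c : all (leq 1) c -> c != [::] ->
  m \in block_word m c.
Proof. by case: c => [|[|a] c] //= _ _; rewrite inE eqxx. Qed.

Lemma count_block_word_lt m c x : all (leq 1) c -> x < m ->
  count_mem x (block_word m c) = 0.
Proof.
move=> c_gt0 x_lt; apply/count_memPn/negP => /(block_word_bounds _ _ _ c_gt0).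
lia.
Qed.

Lemma undup_block_word_cons m a c : 0 < a -> all (leq 1) c ->
  perm_eq (undup (block_word m (a :: c))) (m :: undup (block_word (m + a) c)).
Proof.
move=> a_gt0 c_gt0.
have m_notin : m \notin block_word (m + a) c.
  by apply/negP => /(block_word_bounds _ _ _ c_gt0); lia.
apply/uniq_perm; rewrite ?undup_uniq //= ?undup_uniq ?mem_undup ?andbT //.
by move=> x; rewrite !(inE, mem_undup) mem_cat mem_nseq a_gt0.
Qed.

Lemma size_undup_block_word m c : all (leq 1) c ->
  size (undup (block_word m c)) = size c.
Proof.
elim: c m => [//|a c IH] m /andP[a_gt0 c_gt0].
by rewrite (perm_size (undup_block_word_cons _ _ _ _ _)) //= IH.
Qed.

(** Positive parts give distinct blocks distinct letters, so each part is the multiplicity of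
    exactly one letter. This yields the denominator of the multinomial coefficient. *)
Lemma prod_fact_count_block_word m c : all (leq 1) c ->
  \prod_(y <- undup (block_word m c)) (count_mem y (block_word m c))`! =
  \prod_(x <- c) x`!.
Proof.
elim: c m => [|a c IH] m; first by rewrite !big_nil.
case/andP=> a_gt0 c_gt0.
rewrite (perm_big _ (undup_block_word_cons _ _ _ _ _)) //= !big_cons.
rewrite count_cat count_nseq /= eqxx mul1n count_block_word_lt ?addn0; [|done|lia].
congr (_ * _); rewrite -(IH (m + a)) //; apply: eq_big_seq => y.
rewrite mem_undup => /(block_word_bounds _ _ _ c_gt0) y_ge.
by rewrite count_cat count_nseq /=; have /negPf-> : m != y by lia.
Qed.

(** For [x] in the first block, [y] lies in a later one, hence [y >= m + a], while [m + a] itself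
    occurs and bounds [y] from above. For [x] in a later block, the first block affects neither the
    multiplicity of [x] nor its next value. *)
Lemma block_word_next m c x y : all (leq 1) c -> x \in block_word m c ->
  next_value (block_word m c) x y -> y = x + count_mem x (block_word m c).
Proof.
elim: c m => //= a c IH m /andP[a_gt0 c_gt0] x_in /and3P[y_in x_lt /allP y_min].
rewrite count_cat count_nseq /=.
move: x_in y_in; rewrite !mem_cat !mem_nseq a_gt0 /=.
case: (eqVneq x m) => [x_m _|x_neq /= x_in].
  rewrite x_m in x_lt y_min *; rewrite mul1n count_block_word_lt; [|done|lia].
  case: (eqVneq y m) => [|_ /= y_in]; first by lia.
  have c_neq0 : c != [::] by case: (c) y_in.
  have := block_word_bounds _ _ _ c_gt0 y_in.
  have := y_min (m + a).
  by rewrite mem_cat mem_block_word_start ?orbT // => /(_ isT); lia.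
have := block_word_bounds _ _ _ c_gt0 x_in => x_ge.
case: (eqVneq y m) => [|_ /= y_in]; first by lia.
rewrite mul0n add0n; apply: IH => //.
rewrite /next_value y_in x_lt; apply/allP => z z_in.
by apply: y_min; rewrite mem_cat z_in orbT.
Qed.

(** * Position vectors of block words *)

(* [position_prefix] unfolded from the left, starting at the value [m]. *)
Fixpoint position_from (m : nat) (b : seq nat) (k : nat) : seq nat :=
  if k is k'.+1 then
    count_mem m b :: position_from (m + count_mem m b) b k'
  else [::].

Lemma position_from_rcons m b k :
  position_from m b k.+1 =
  rcons (position_from m b k)
        (count_mem (m + sumn (position_from m b k)) b).
Proof.
elim: k m => [|k IH] m; first by rewrite /= addn0.
by rewrite -[LHS]/(_ :: position_from _ _ k.+1) IH /= addnA.
Qed.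

Lemma position_prefixE b k : position_prefix b k = position_from 1 b k.
Proof. by elim: k => //= k ->; rewrite -position_from_rcons. Qed.

Lemma eq_position_from m b b' k :
  (forall x, m <= x -> count_mem x b = count_mem x b') ->
  position_from m b k = position_from m b' k.
Proof.
elim: k m => //= k IH m eq_bb'; rewrite eq_bb' //; congr (_ :: _).
by apply: IH => x x_ge; apply: eq_bb'; lia.
Qed.

Lemma position_from_block_word m c : all (leq 1) c ->
  position_from m (block_word m c) (size c) = c.
Proof.
elim: c m => //= a c IH m /andP[a_gt0 c_gt0].
rewrite count_cat count_nseq /= eqxx mul1n.
rewrite count_block_word_lt ?addn0 //; last by lia.
congr (_ :: _); rewrite -[RHS](IH (m + a)) //.
apply: eq_position_from => x x_ge; rewrite count_cat count_nseq /=.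
by have /negPf-> : m != x by lia.
Qed.

Lemma position_vector_block_word b c : all (leq 1) c ->
  perm_eq b (block_word 1 c) -> position_vector b = c.
Proof.
move=> c_gt0 b_perm; rewrite /position_vector position_prefixE.
have -> : size (undup b) = size c.
  by rewrite (perm_size (perm_undup (perm_mem b_perm))) size_undup_block_word.
rewrite -[RHS](position_from_block_word 1 c) //.
by apply: eq_position_from => x _; apply/permP.
Qed.

Lemma perm_next_value b b' x y : perm_eq b b' ->
  next_value b x y = next_value b' x y.
Proof.
by move=> bb'; rewrite /next_value (perm_mem bb') (perm_all _ bb').
Qed.

Lemma fubini_seq_block_word n b c : 0 < n -> all (leq 1) c -> sumn c = n ->
  perm_eq b (block_word 1 c) -> fubini_seq n b.
Proof.
move=> n_gt0 c_gt0 c_sum b_perm; apply/and4P; split.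
- by rewrite (perm_size b_perm) size_block_word c_sum.
- apply/allP => x; rewrite (perm_mem b_perm) => /(block_word_bounds _ _ _ c_gt0).
  lia.
- rewrite (perm_mem b_perm) mem_block_word_start //.
  by case: (c) c_sum n_gt0 => //= <-.
- apply/allP => x x_in; apply/allP => y _; apply/implyP.
  rewrite (perm_next_value _ _ _ _ b_perm) (permP b_perm).
  move=> /block_word_next-> //.
  by rewrite -(perm_mem b_perm).
Qed.

(** * From the gap condition to block words *)

Lemma ex_min_seq (b : seq nat) : b != [::] ->
  exists2 y, y \in b & {in b, forall z, y <= z}.
Proof.
elim: b => // x b IH _; have [->|/IH[y y_in y_min]] := eqVneq b [::].
  by exists x; rewrite ?inE // => z; rewrite inE => /eqP->.
have [xy|yx] := leqP x y.
  exists x; rewrite ?inE ?eqxx // => z; rewrite inE => /orP[/eqP->//|/y_min]; lia.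
by exists y; rewrite ?inE ?y_in ?orbT // => z; rewrite inE => /orP[/eqP->|/y_min]; lia.
Qed.

(** Strong induction on the length: remove all [a] copies of the least letter [m]. The least
    remaining letter is the next value after [m], hence [m + a], and the gap condition survives
    because letters above [m] keep their multiplicities and next values. *)
Lemma block_word_of_gaps m (b : seq nat) :
  {in b, forall x, m <= x} -> (b != [::] -> m \in b) ->
  {in b, forall x y, next_value b x y -> y = x + count_mem x b} ->
  exists2 c, all (leq 1) c & perm_eq b (block_word m c).
Proof.
elim: {b}(size b) {-2}b (leqnn (size b)) m => [|N IH] b b_size m b_ge m_in b_next.
  by exists [::] => //; case: (b) b_size.
have [b0|b_neq0] := eqVneq b [::]; first by exists [::]; rewrite ?b0.
move/(_ b_neq0): m_in => m_in; set a := count_mem m b.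
have a_gt0 : 0 < a by rewrite -has_count has_pred1.
pose b' := filter (predC1 m) b.
have b_perm : perm_eq b (nseq a m ++ b').
  rewrite perm_sym /a -size_filter -(all_pred1P _ _ (filter_all _ _)).
  exact: (permEl (perm_filterC _ _)).
have count_b' x : x != m -> count_mem x b' = count_mem x b.
  move=> x_neq; rewrite (permP b_perm) count_cat count_nseq /= eq_sym.
  by rewrite (negPf x_neq).
have mem_b' x : (x \in b') = (x != m) && (x \in b) by rewrite mem_filter.
have next_b' x y : m < x -> next_value b' x y = next_value b x y.
  move=> x_gt; rewrite /next_value mem_b'; have [->|y_neq] := eqVneq y m.
    by rewrite (ltnNge x m) ltnW //= andbF.
  congr [&& _, _ & _]; apply/allP/allP => y_min z.
    move=> z_in; have [->|z_neq] := eqVneq z m; first by rewrite ltnNge ltnW.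
    by apply: y_min; rewrite mem_b' z_neq.
  by rewrite mem_b' => /andP[_]; apply: y_min.
have b'_gt x : x \in b' -> m < x.
  by rewrite mem_b' => /andP[x_neq /b_ge]; lia.
have b'_start : b' != [::] -> m + a \in b' /\ {in b', forall x, m + a <= x}.
  move=> /ex_min_seq[y y_in y_min].
  suff <- : y = m + a by [].
  apply: b_next => //; apply/and3P; split; last 2 first.
  - exact: b'_gt.
  - apply/allP => z z_in; apply/implyP => z_gt; apply: y_min.
    by rewrite mem_b' z_in andbT; lia.
  - by move: y_in; rewrite mem_b' => /andP[].
have [||||c c_gt0 c_perm] := IH b' _ (m + a).
(* As [m] occurs in [b], [a] is positive and [b'] is strictly shorter. *)
- rewrite -ltnS (leq_trans _ b_size) // (perm_size b_perm) size_cat size_nseq.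
  by rewrite -[X in X < _]add0n ltn_add2r.
- move=> x x_in; have /b'_start[_] : b' != [::] by case: (b') x_in.
  exact.
- by case/b'_start.
- move=> x x_in y; have x_gt := b'_gt _ x_in.
  rewrite next_b' // count_b'; last by lia.
  by apply: b_next; move: x_in; rewrite mem_b' => /andP[].
exists (a :: c); rewrite /= ?a_gt0 //.
by rewrite (perm_trans b_perm) // perm_cat2l.
Qed.

Lemma fubini_seqP n (b : seq nat) : 0 < n ->
  reflect (exists c, [/\ all (leq 1) c, sumn c = n & perm_eq b (block_word 1 c)])
          (fubini_seq n b).
Proof.
move=> n_gt0; apply: (iffP idP) => [|[c [c_gt0 c_sum]]]; last first.
  exact: fubini_seq_block_word.
case/and4P=> /eqP b_size /allP b_bounds b1 /allP b_next.
have [|//||c c_gt0 c_perm] := block_word_of_gaps 1 b.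
- by move=> x /b_bounds /andP[].
- move=> x x_in y xy; move/allP: (b_next x x_in) => /(_ y).
  by have /and3P[y_in _ _] := xy; rewrite y_in xy => /(_ isT) /eqP.
by exists c; split=> //; rewrite -(size_block_word 1) -(perm_size c_perm).
Qed.

(** * Counting the rearrangements of a word *)

(* Any duplicate-free [r] containing the letters of [w] is allowed, so that the
   same [r] serves for [w] and for [rem x w] in the induction. *)
Lemma size_permutations_multiset (T : eqType) (w r : seq T) :
  uniq r -> {subset w <= r} ->
  size (permutations w) * \prod_(y <- r) (count_mem y w)`! = (size w)`!.
Proof.
move=> r_uniq; elim: {w}(size w) {-2}w (erefl (size w)) => [|N IH] w w_size w_sub.
  by rewrite (size0nil w_size) big1.
have w_gt0 : 0 < size w by rewrite w_size.
(* Permutations of [w] are grouped by their first letter [x]; what follows it is a permutation of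
   [rem x w]. *)
rewrite (perm_size (permutationsE w_gt0)) size_allpairs_dep sumnE big_map.
rewrite big_distrl /= [in RHS]w_size factS -[in N.+1]w_size -[size w]count_predT.
(* Writing the length of [w] as the sum of its multiplicities splits the identity letter by letter:
   deleting one [x] divides the product of factorials by [count_mem x w]. *)
have <- : \sum_(x <- undup w) count_mem x w = count predT w.
  rewrite count_predT -[RHS](perm_size (perm_count_undup w)) size_flatten.
  rewrite /shape -map_comp sumnE big_map.
  by apply: eq_bigr => x _ /=; rewrite size_nseq.
rewrite big_distrl /=; apply: eq_big_seq => x; rewrite mem_undup => x_in.
have rem_size : size (rem x w) = N by rewrite size_rem // w_size.
rewrite -rem_size -IH //; last by move=> y /mem_rem /w_sub.
rewrite mulnCA; congr (_ * _).
rewrite !(bigD1_seq x) ?w_sub //= mulnA; congr (_ * _).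
  rewrite count_mem_rem eqxx.
  have : 0 < count_mem x w by rewrite -has_count has_pred1.
  by case: (count_mem x w) => // q _; rewrite factS subn1.
apply: eq_bigr => y y_neq.
by rewrite count_mem_rem eq_sym (negPf y_neq) subn0.
Qed.

Lemma entries_inj n k : injective (@entries n k).
Proof. by move=> b b' /(inj_map val_inj) /val_inj. Qed.

Lemma exists_entries n k (t : seq nat) : size t = k -> all (leq^~ n) t ->
  exists b : k.-tuple 'I_n.+1, entries b = t.
Proof.
move=> t_size /allP t_le.
have b_size : size [seq inord x : 'I_n.+1 | x <- t] == k by rewrite size_map t_size.
exists (Tuple b_size); rewrite /entries /= -map_comp.
by apply/map_id_in => x /t_le x_le /=; rewrite inordK.
Qed.

Lemma card_perm_entries n (w : seq nat) : size w = n -> all (leq^~ n) w ->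
  #|[set b : n.-tuple 'I_n.+1 | perm_eq (entries b) w]| = size (permutations w).
Proof.
move=> w_size w_le; rewrite cardE -(size_map (@entries n n)).
apply/perm_size/uniq_perm; first by rewrite map_inj_uniq ?enum_uniq //; apply: entries_inj.
  exact: permutations_uniq.
move=> t; rewrite mem_permutations; apply/mapP/idP => [[b]|t_perm].
  by rewrite mem_enum inE => ? ->.
have [||b b_t] := exists_entries n n t.
- by rewrite (perm_size t_perm).
- by rewrite (perm_all _ t_perm).
by exists b; rewrite ?mem_enum ?inE b_t.
Qed.

Lemma card_perm_block_word n c : all (leq 1) c -> sumn c = n ->
  #|[set b : n.-tuple 'I_n.+1 | perm_eq (entries b) (block_word 1 c)]| =
  multinomial n c.
Proof.
move=> c_gt0 c_sum; have w_size := size_block_word 1 c.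
rewrite card_perm_entries ?w_size //; last first.
  by apply/allP => x /(block_word_bounds _ _ _ c_gt0); lia.
rewrite /multinomial -c_sum -w_size.
rewrite -(size_permutations_multiset _ _ (undup (block_word 1 c))) ?undup_uniq //.
  (* The numerator is now a multiple of the product of factorials, so the division is exact. *)
  rewrite prod_fact_count_block_word // mulnK // prodn_gt0 // => x.
  exact: fact_gt0.
by move=> x; rewrite mem_undup.
Qed.

(** * Summation over position vectors *)

Lemma mem_M s k n (c : k.-tuple 'I_n.+1) :
  (c \in M s k n) =
  [&& sumn (entries c) == n, all (leq 1) (entries c) &
      all (fun i => nth 0 (entries c) i <= s i) (iota 0 k)].
Proof.
have nth_c (i : 'I_k) : nth 0 (entries c) i = tnth c i.
  by rewrite (nth_map ord0) ?size_tuple // (tnth_nth ord0).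
rewrite inE sumnE big_map big_tuple; congr (_ && _).
apply/forallP/andP => [c_bounds|[/allP c_gt0 /allP c_le] i].
  split; apply/allP.
    by move=> _ /mapP[_ /tnthP[i ->] ->]; case/andP: (c_bounds i).
  move=> i; rewrite mem_iota => /andP[_ i_lt].
  by rewrite (nth_c (Ordinal i_lt)); case/andP: (c_bounds (Ordinal i_lt)).
apply/andP; split; first by apply/c_gt0/map_f/mem_tnth.
by rewrite -nth_c c_le // mem_iota /= add0n ltn_ord.
Qed.

(** The double sum has at most one nonzero term, found at the position vector of [b]. *)
Lemma FRT3_position_vector n s (b : n.-tuple 'I_n.+1) : 0 < n ->
  (b \in FRT3 n s : nat) =
  \sum_(1 <= k < n.+1) \sum_(c in M s k n)
     perm_eq (entries b) (block_word 1 (entries c)).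
Proof.
move=> n_gt0; have [|b_notin] := boolP (b \in FRT3 n s); last first.
  rewrite big1 // => k _; rewrite big1 // => c.
  rewrite mem_M => /and3P[/eqP c_sum c_gt0 c_le]; apply/eqP; rewrite eqb0.
  apply: contra b_notin => b_perm; rewrite inE; apply/andP; split.
    by apply/fubini_seqP => //; exists (entries c).
  rewrite /block_sequence (position_vector_block_word _ _ c_gt0 b_perm).
  by rewrite size_map size_tuple.
rewrite inE => /andP[/fubini_seqP-/(_ n_gt0)[p [p_gt0 p_sum b_perm]]].
rewrite /block_sequence (position_vector_block_word _ _ p_gt0 b_perm) => p_le.
(* [c0] is [p] as a bounded tuple: parts of a composition of [n] are at most [n]. *)
have [||c0 c0_p] := exists_entries n (size p) p; first by [].
  by apply/allP => x x_in; rewrite -p_sum sumnE (big_rem x) //= leq_addr.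
(* Both [c] and [p] equal the position vector of [b]. *)
have uniq_p k (c : k.-tuple 'I_n.+1) : c \in M s k n ->
    perm_eq (entries b) (block_word 1 (entries c)) -> entries c = p.
  rewrite mem_M => /and3P[_ c_gt0 _] /(position_vector_block_word _ _ c_gt0) <-.
  exact: position_vector_block_word.
(* This puts [size p] in the range of the outer sum. *)
have p_size : 1 <= size p <= n.
  rewrite -p_sum; apply/andP; split.
    by case: (p) p_sum n_gt0 => //= <-.
  elim: (p) p_gt0 => //= x q IH /andP[x_gt0 /IH]; lia.
rewrite (bigD1_seq (size p)) ?mem_index_iota ?iota_uniq //= (bigD1 c0) /=; last first.
  by rewrite mem_M c0_p p_sum eqxx p_gt0.
rewrite c0_p b_perm !big1 // => [k k_neq|c /andP[c_in c_neq]].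
  rewrite big1 // => c c_in; apply/eqP; rewrite eqb0.
  apply: contra k_neq => /(uniq_p _ _ c_in) <-.
  by rewrite size_map size_tuple.
apply/eqP; rewrite eqb0; apply: contra c_neq => /(uniq_p _ _ c_in) c_p.
by apply/eqP/entries_inj; rewrite c_p.
Qed.

Theorem theorem5p5 (n : nat) (hn : 0 < n)
    (s : nat -> nat) (hs : forall i, 0 < s i) :
  #|FRT3 n s| =
  \sum_(1 <= k < n.+1) \sum_(c in M s k n) multinomial n (entries c).
Proof.
rewrite -sum1_card big_mkcond /=.
(* Double counting: after the exchanges, each [c] collects the tuples that rearrange its block
   word. *)
under eq_bigr => b _ do rewrite -[if _ then _ else _]/(b \in FRT3 n s : nat) FRT3_position_vector //.
rewrite exchange_big /=; apply: eq_bigr => k _.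
rewrite exchange_big /=; apply: eq_bigr => c.
rewrite mem_M => /and3P[/eqP c_sum c_gt0 _].
rewrite -card_perm_block_word // -sum1_card [RHS]big_mkcond /=.
by apply: eq_bigr => b _; rewrite inE; case: perm_eq.
Qed.
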